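(* Let $F$ be a field of characteristic different from $2$ with $\nu_{2^\infty_F}<\infty$, let $e>\nu_{2^\infty_F}$ be an integer, and write $\nu=\nu_{2^\infty_F}$, $\nu^+=\nu^+_{2^\infty_F}$. The following assertions are equivalent: (1) $\operatorname{Gal}(F(\zeta_{2^e})/F)$ is not cyclic. (2) $\sigma_{-1},\sigma_{5^{2^{e-3}}}\in\operatorname{Gal}(F(\zeta_{2^e})/F)$ and the subgroup $\langle\sigma_{-1},\sigma_{5^{2^{e-3}}}\rangle$ has order $4$. (3) $F(\zeta_{2^e})/F$ admits exactly three distinct subextensions $M$ with $[F(\zeta_{2^e}):M]=2$, and they are $F(\zeta_{2^{e-1}})$, $F(\zeta_{2^e}+\zeta_{2^e}^{-1})$, $F(\zeta_{2^e}-\zeta_{2^e}^{-1})$. (4) $F(\zeta_{2^e})/F$ has exactly $2(e-\nu)+1$ distinct $2$-tower decompositions, and they are precisely: (a) $F(\zeta_{2^e})/F(\zeta_{2^{e-1}})/\cdots/F(\zeta_{2^{\nu}})/F$; (b) $F(\zeta_{2^e})/\cdots/F(\zeta_{2^{e-r}})/F(\zeta_{2^{e-r}}+\zeta_{2^{e-r}}^{-1})/F(\zeta_{2^{e-r-1}}+\zeta_{2^{e-r-1}}^{-1})/\cdots/F(\zeta_{2^{\nu^++1}}+\zeta_{2^{\nu^++1}}^{-1})/F$; (c) $F(\zeta_{2^e})/\cdots/F(\zeta_{2^{e-r}})/F(\zeta_{2^{e-r}}-\zeta_{2^{e-r}}^{-1})/F(\zeta_{2^{e-(r+1)}}+\zeta_{2^{e-(r+1)}}^{-1})/\cdots/F(\zeta_{2^{\nu^++1}}+\zeta_{2^{\nu^++1}}^{-1})/F$;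 where $r$ ranges over $\{0,\dots,e-(\nu+1)\}$. (5) $\zeta_4\notin F$ and $\zeta_{2^{\nu}}-\zeta_{2^{\nu}}^{-1}\notin F$. Moreover, if $F(\zeta_{2^e})/F$ is not cyclic, then $F$ has characteristic $0$.
   Context: All fields lie in a fixed algebraic closure $\overline{F}$. Fix compatible primitive $2^k$-th roots of unity $\zeta_{2^k}$ ($\zeta_{2^{k+1}}^2=\zeta_{2^k}$). For $\alpha\in\overline{F}^\times$ with a positive power in $F$, $o_F(\alpha)$ is the least positive $m$ with $\alpha^m\in F$. $t_F(2^k)=2^k$ if $o_F(\zeta_{2^k})>2$, $=2$ if $o_F(\zeta_{2^k})=2$, $=1$ if $o_F(\zeta_{2^k})=1$. $\nu^+_{2^\infty_F}=\max\{k\in\mathbb{N}:\zeta_{t_F(2^k)}+\zeta_{t_F(2^k)}^{-1}\in F\}$ (or $\infty$). $F$ has property $\mathcal{C}_2$ if some $k$ satisfies $\zeta_{2^k}\notin F$, $o_F(\zeta_{2^k})=2^{k-1}$, $\zeta_{2^k}-\zeta_{2^k}^{-1}\in F$. $\nu_{2^\infty_F}=\nu^+_{2^\infty_F}+1$ if $F$ has property $\mathcal{C}_2$, else $\nu^+_{2^\infty_F}$. For odd $j$, $\sigma_j$ is the $F$-automorphism of $F(\zeta_{2^e})$ sending $\zeta_{2^e}\mapsto\zeta_{2^e}^j$ (when it exists). A $2$-tower decomposition of a finite extension $K/F$ is a chain $F=K_0\subseteq K_1\subseteq\cdots\subseteq K_s=K$ with $[K_{i+1}:K_i]=2$, written $K_s/K_{s-1}/\cdots/K_0$.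 *)

(* Defs.v *)
From HB Require Import structures.
From mathcomp Require Import all_boot all_order all_fingroup all_algebra all_solvable all_field.

Set Implicit Arguments.
Unset Strict Implicit.
Unset Printing Implicit Defensive.

Import GRing.Theory.
Local Open Scope ring_scope.

Section TwoPowerRoots.

(* [zeta k] is the 2^k-th root of unity: roots are indexed by the exponent k. *)
Variables (F : fieldType) (Fbar : closedFieldType).
Variables (iota : {rmorphism F -> Fbar}) (zeta : nat -> Fbar).

Definition compatible_roots : Prop :=
  forall k, (2 ^ k).-primitive_root (zeta k) /\ zeta k.+1 ^+ 2 = zeta k.

Definition in_base (x : Fbar) : Prop := exists a : F, x = iota a.

(* o_F(x) = m; o_F is partial, hence a relation. *)
Definition has_oF (x : Fbar) (m : nat) : Prop :=
  [/\ (0 < m)%N, in_base (x ^+ m) &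
      forall n, (0 < n)%N -> in_base (x ^+ n) -> (m <= n)%N].

(* t_F(2^k) = 2^(tF_exp k m), where m = o_F(zeta k). *)
Definition tF_exp (k m : nat) : nat :=
  if (2 < m)%N then k else if m == 2%N then 1%N else 0%N.

Definition nu_plus_cond (k : nat) : Prop :=
  exists m, has_oF (zeta k) m /\
    in_base (zeta (tF_exp k m) + (zeta (tF_exp k m))^-1).

(* nu^+ is finite and equal to n. *)
Definition is_nu_plus (n : nat) : Prop :=
  nu_plus_cond n /\ forall k, nu_plus_cond k -> (k <= n)%N.

Definition property_C2 : Prop :=
  exists k, [/\ ~ in_base (zeta k), has_oF (zeta k) (2 ^ k.-1) &
                in_base (zeta k - (zeta k)^-1)].

(* nu is finite and equal to n. *)
Definition is_nu (n : nat) : Prop :=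
  exists np, is_nu_plus np /\
    ((property_C2 /\ n = np.+1) \/ (~ property_C2 /\ n = np)).

End TwoPowerRoots.

Section Towers.

Variables (F : fieldType) (L : splittingFieldType F).

Definition adjF (x : L) : {subfield L} := <<1; x>>%AS.

(* s is sigma_j on F(x). *)
Definition is_sigma (x : L) (j : int) (s : gal_of (adjF x)) : Prop :=
  s \in 'Gal(adjF x / 1)%g /\ s x = x ^ j.

Definition index2 (E M : {subfield L}) : bool :=
  (M <= E)%VS && (\dim_M E == 2%N).

(* A chain is listed from the top field K_s down to K_0 = F. *)
Definition two_tower (K : {subfield L}) (t : seq {subfield L}) : bool :=
  if t is E :: s then
    [&& E == K, path index2 E s & last E s == 1%AS]
  else false.

(* z k is the 2^k-th root of unity. *)
Variable z : nat -> L.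

Definition Fzeta (k : nat) : {subfield L} := adjF (z k).
Definition Fplus (k : nat) : {subfield L} := adjF (z k + (z k)^-1).
Definition Fminus (k : nat) : {subfield L} := adjF (z k - (z k)^-1).

(* [:: n; n - 1; ...; m], empty if n < m. *)
Definition downto (n m : nat) : seq nat := rev (seq.iota m (n.+1 - m)).

Definition tower_a (e nu : nat) : seq {subfield L} :=
  map Fzeta (downto e nu) ++ [:: 1%AS].

Definition tower_b (e nup r : nat) : seq {subfield L} :=
  map Fzeta (downto e (e - r)) ++ map Fplus (downto (e - r) nup.+1)
    ++ [:: 1%AS].

Definition tower_c (e nup r : nat) : seq {subfield L} :=
  map Fzeta (downto e (e - r)) ++ [:: Fminus (e - r)]
    ++ map Fplus (downto (e - r.+1) nup.+1) ++ [:: 1%AS].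

(* r ranges over 0, ..., e - (nu + 1). *)
Definition listed_towers (e nu nup : nat) : seq (seq {subfield L}) :=
  tower_a e nu :: map (tower_b e nup) (seq.iota 0 (e - nu))
    ++ map (tower_c e nup) (seq.iota 0 (e - nu)).

End Towers.

Arguments is_sigma {F L} x j s.

(* Main.v *)
(* Write zeta = zeta_{2^e}. An involution of F(zeta)/F sends zeta to -zeta or
   to +-1/zeta, and a noncyclic abelian 2-group contains three involutions; hence
   each of (1)-(4) puts sigma_{-1} : zeta |-> 1/zeta in the Galois group.
   Since sigma_{-1} negates zeta_4 and zeta_{2^nu} - 1/zeta_{2^nu}, this gives (5).
   Conversely, (5) forces nu = nu^+ and excludes property C_2, so that some
   automorphism t fixes zeta_{2^nu} and negates zeta_{2^(nu+1)}; squaring t again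
   and again negates zeta_{2^k} at every level k > nu, and these sign changes
   correct an automorphism inverting zeta_{2^nu} into one inverting zeta. The
   resulting Klein four-group at every level determines all index 2 subfields:
   three below F(zeta_{2^k}), only F(zeta_{2^(k-1)} + 1/zeta_{2^(k-1)}) below
   F(zeta_{2^k} +- 1/zeta_{2^k}), and the towers follow by induction on k.
   In characteristic p with zeta_4 not in F, Frobenius exhibits property C_2. *)

Require Import Defs.
From HB Require Import structures.
From mathcomp Require Import all_boot all_order all_fingroup all_algebra all_solvable all_field.
From mathcomp Require Import ring zify.

Set Implicit Arguments.
Unset Strict Implicit.
Unset Printing Implicit Defensive.

Import GRing.Theory.
Local Open Scope ring_scope.

(** * Compatible chains of 2-power roots of unity *)

Definition root_chain (R : fieldType) (z : nat -> R) (e : nat) : Prop :=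
  forall k, (k <= e)%N ->
    (2 ^ k).-primitive_root (z k) /\ ((k < e)%N -> z k.+1 ^+ 2 = z k).

Section RootChain.

Variables (R : fieldType) (z : nat -> R) (e : nat).
Hypothesis zP : root_chain z e.

(** Truncation lets results stated at the top level [e] be applied at every lower level. *)
Lemma root_chainS k : (k <= e)%N -> root_chain z k.
Proof.
move=> le_ke i le_ik; have [prim_zi zS] := zP (leq_trans le_ik le_ke).
by split=> // lt_ik; apply/zS/(leq_trans lt_ik).
Qed.

Lemma root_chain_sqr k : (k < e)%N -> z k.+1 ^+ 2 = z k.
Proof. by move=> lt_ke; have [_ ->] := zP (ltnW lt_ke). Qed.

Lemma root_chainX k m : (k + m <= e)%N -> z (k + m)%N ^+ (2 ^ m) = z k.
Proof.
elim: m => [|m IHm]; first by rewrite addn0 expr1.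
by rewrite addnS => lt_e; rewrite expnS exprM root_chain_sqr // IHm // ltnW.
Qed.

Lemma root_chain_neq0 k : (k <= e)%N -> z k != 0.
Proof. by move=> /zP[/prim_root_eq0-> _]; rewrite expn_eq0. Qed.

Hypothesis e_gt0 : (0 < e)%N.

Lemma root_chain1 : z 1 = -1.
Proof.
have [prim1 _] := zP e_gt0; have := prim_expr_order prim1.
move/eqP; rewrite -{1}(expr1n R 2) eqf_sqr => /orP[|/eqP//].
by rewrite -(prim_order_dvd prim1 1).
Qed.

Lemma root_chain_char : 2 != 0 :> R.
Proof. by have [prim1 _] := zP e_gt0; apply: prim_root_natf_neq0 prim1. Qed.

Lemma root_chain_sqr_neq1 k : (1 < k <= e)%N -> z k ^+ 2 != 1.
Proof.
case/andP=> k_gt1 /zP[prim_k _]; rewrite -(prim_order_dvd prim_k).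
by rewrite -{2}(expn1 2) dvdn_Pexp2l // -ltnNge.
Qed.

Lemma root_chain_sqr_neqN1 k : (2 < k <= e)%N -> z k ^+ 2 != -1.
Proof.
case/andP=> k_gt2 le_ke; case: k k_gt2 le_ke => // k k_gt1 lt_ke.
rewrite root_chain_sqr //; apply: contra (root_chain_sqr_neq1 (k := k) _).
  by move/eqP->; rewrite sqrrN expr1n.
by apply/andP; split=> //; apply: ltnW.
Qed.

Lemma root_chain_neqV k : (1 < k <= e)%N -> (z k)^-1 != z k.
Proof.
move=> kP; have z0: z k != 0 by case/andP: kP => _ /root_chain_neq0.
apply: contra (root_chain_sqr_neq1 kP) => /eqP eqV.
by rewrite expr2 -{1}eqV mulVf.
Qed.

Lemma root_chain_neqNV k : (2 < k <= e)%N -> - (z k)^-1 != z k.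
Proof.
move=> kP; have z0: z k != 0 by case/andP: kP => _ /root_chain_neq0.
apply: contra (root_chain_sqr_neqN1 kP) => /eqP eqV.
by rewrite expr2 -{1}eqV mulNr mulVf.
Qed.

Lemma root_chain_oppr_neq (x : R) : x != 0 -> - x != x.
Proof.
move=> x0; rewrite eq_sym -subr_eq0 opprK -mulr2n -mulr_natl mulf_neq0 //.
exact: root_chain_char.
Qed.

End RootChain.

(** The product (y - x)(y - 1/x) is y times the difference of the two sums. With [y] a conjugate of
    [x]: an automorphism fixing x + 1/x fixes or inverts x. *)
Lemma addV_inj (R : fieldType) (x y : R) : x != 0 -> y != 0 ->
  x + x^-1 = y + y^-1 -> y = x \/ y = x^-1.
Proof.
move=> x0 y0 eq_xy; have: (y - x) * (y - x^-1) = 0.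
  transitivity (y * ((y + y^-1) - (x + x^-1))); first by field; rewrite x0.
  by rewrite eq_xy subrr mulr0.
by move/eqP; rewrite mulf_eq0 !subr_eq0 => /orP[]/eqP; [left | right].
Qed.

(** * Quadratic steps between subfields *)

Section Quadratic.

Variables (F : fieldType) (L : splittingFieldType F).
Implicit Types (K M : {subfield L}) (x y a b : L).

Lemma adjoin_degree_le2 K x a b :
  a \in K -> b \in K -> x ^+ 2 = a * x + b -> (adjoin_degree K x <= 2)%N.
Proof.
move=> Ka Kb Dx; pose p : {poly L} := 'X^2 - (a *: 'X + b%:P).
have Kp: p \is a polyOver K.
  by rewrite !(rpredB, rpredD, polyOverZ, polyOverX, polyOverC) ?rpredX
     ?polyOverX.
have px: root p x by rewrite rootE !hornerE Dx subrr.
have sz_p: size p = 3.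
  rewrite size_polyDl size_polyXn // size_polyN.
  rewrite (leq_ltn_trans (size_polyD _ _)) // gtn_max.
  rewrite (leq_ltn_trans (size_scale_leq _ _)) ?size_polyX //.
  by rewrite (leq_ltn_trans (size_polyC_leq1 _)).
have p_neq0: p != 0 by rewrite -size_poly_gt0 sz_p.
have := dvdp_leq p_neq0 (minPoly_dvdp Kp px).
by rewrite size_minPoly sz_p.
Qed.

Lemma adjF_sup K x : (K <= adjF x)%VS -> adjF x = <<K; x>>%AS.
Proof.
move=> sKx; apply/val_inj/eqP; rewrite eqEsubv /=.
apply/andP; split; apply/FadjoinP; last by rewrite memv_adjoin.
by rewrite sub1v memv_adjoin.
Qed.

Lemma mem_adjF x : x \in adjF x.
Proof. exact: memv_adjoin. Qed.

Lemma sub_adjF x M : (adjF x <= M)%VS = (x \in M).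
Proof. by apply/FadjoinP/idP => [[] //|]; rewrite sub1v. Qed.

(** The quadratic equation bounds the degree by 2, and [x \notin K] excludes degree 1. *)
Lemma index2_adjF K x a b :
    x \notin K -> (K <= adjF x)%VS -> a \in K -> b \in K ->
  x ^+ 2 = a * x + b -> index2 (adjF x) K.
Proof.
move=> K'x sKx Ka Kb Dx; rewrite /index2 sKx (adjF_sup sKx) -adjoin_degreeE.
rewrite eqn_leq (adjoin_degree_le2 Ka Kb Dx) ltn_neqAle.
by rewrite eq_sym adjoin_deg_eq1 K'x.
Qed.

Lemma index2_dim K M : index2 K M -> \dim K = (2 * \dim M)%N.
Proof. by case/andP=> sMK /eqP dimK; rewrite (dim_sup_field sMK) dimK. Qed.

Lemma index2_sub K M : index2 K M -> (M <= K)%VS.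
Proof. by case/andP. Qed.

Lemma subfield_eq_dim K M : (K <= M)%VS -> \dim K = \dim M -> K = M.
Proof.
by move=> sKM eq_dim; apply/val_inj/eqP; rewrite /= eqEdim sKM eq_dim leqnn.
Qed.

Lemma index2_inj K M1 M2 :
  index2 K M1 -> index2 K M2 -> (M1 <= M2)%VS -> M1 = M2.
Proof.
move=> /index2_dim dK1 /index2_dim dK2 sM; apply: subfield_eq_dim sM _.
by apply/eqP; rewrite -(eqn_pmul2l (isT : 0 < 2)%N) -dK1 dK2.
Qed.

Lemma index2_notin x M : index2 (adjF x) M -> x \notin M.
Proof.
case/andP=> sMx dimM; apply: contraL dimM => Mx.
suff ->: adjF x = M by rewrite divnn adim_gt0.
by apply/val_inj/eqP; rewrite /= eqEsubv sMx andbT sub_adjF.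
Qed.

Lemma index2_1 M : index2 1%AS M = false.
Proof.
apply/negP=> /index2_dim; rewrite dimv1; have := adim_gt0 M.
by case: (\dim M) => // d; rewrite mulnS.
Qed.

End Quadratic.

(** * The Galois group of F(zeta)/F *)

Section CyclotomicGalois.

Variables (F : fieldType) (L : splittingFieldType F) (z : nat -> L) (e : nat).
Hypothesis zP : root_chain z e.
Hypothesis e_gt2 : (2 < e)%N.

Let e_gt1 : (1 < e)%N. Proof. exact: ltnW. Qed.
Let e_gt0 : (0 < e)%N. Proof. exact: ltnW. Qed.

Let E := Fzeta z e.
Implicit Types (s t : gal_of E) (M : {subfield L}).

Lemma mem_Fzeta k : (k <= e)%N -> z k \in E.
Proof.
move=> le_ke; rewrite -(root_chainX zP (m := e - k)) subnKC //.
exact/rpredX/mem_adjF.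
Qed.

Lemma mem_Fzeta_pm k : (k <= e)%N ->
  (z k + (z k)^-1 \in E) /\ (z k - (z k)^-1 \in E).
Proof.
by move=> /mem_Fzeta Ezk; rewrite rpredD ?rpredB ?rpredV.
Qed.

Lemma galois_Fzeta : galois 1 E.
Proof.
have [prim_ze _] := zP (leqnn e).
apply/splitting_galoisField; exists ('X^(2 ^ e) - 1); split.
- by rewrite rpredB ?rpred1 ?rpredX ?polyOverX.
- exact/separable_Xn_sub_1/(prim_root_natf_neq0 prim_ze).
exists [seq z e ^+ i | i <- index_iota 0 (2 ^ e)].
  by rewrite big_map factor_Xn_sub_1 ?eqpxx.
apply/eqP; rewrite eqEsubv; apply/andP; split; last first.
  apply/FadjoinP; split; first exact: subv_adjoin_seq.
  apply: seqv_sub_adjoin; apply/mapP; exists 1%N; last by rewrite expr1.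
  by rewrite mem_index_iota (leq_ltn_trans e_gt0 (ltn_expl e _)).
apply/Fadjoin_seqP; split; first exact: sub1v.
by move=> _ /mapP[i _ ->]; apply/rpredX/mem_adjF.
Qed.

Lemma mem_gal1 s : s \in 'Gal(E / 1)%g.
Proof. by rewrite -sub1set galois_connection ?sub1v. Qed.

Lemma mem_gal_adjF s x : x \in E -> s x = x -> s \in 'Gal(E / adjF x)%g.
Proof.
move=> Ex sx; rewrite -sub1set galois_connection ?sub_adjF //.
by apply/fixedFieldP=> // t /set1P->.
Qed.

(** Non-membership is certified by an automorphism fixing the generator [x] and moving [y]. *)
Lemma gal_notin s x y : x \in E -> s x = x -> s y != y -> y \notin adjF x.
Proof.
move=> Ex sx; apply: contra => xy; apply/eqP.
by apply: fixed_gal (mem_gal_adjF Ex sx) xy; rewrite sub_adjF.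
Qed.

Lemma gal_moves M x : (M <= E)%VS -> x \in E -> x \notin M ->
  exists2 s, s \in 'Gal(E / M)%g & s x != x.
Proof.
move=> sME Ex M'x; apply/exists_inP; apply: contraR M'x.
rewrite negb_exists_in => /forall_inP fixM.
have galME: galois M E by apply: galoisS galois_Fzeta; rewrite sub1v.
rewrite -(galois_fixedField galME); apply/fixedFieldP=> // s /fixM.
by rewrite negbK => /eqP.
Qed.

Lemma gal_eq s t : s (z e) = t (z e) -> s = t.
Proof.
by move=> eq_st; apply/eqP; rewrite (gal_adjoin_eq (mem_gal1 s) (mem_gal1 t)) eq_st.
Qed.

Lemma gal_root_pow s : exists i, s (z e) = z e ^+ i.
Proof.
have [prim_ze _] := zP (leqnn e).
have [|i ->] := prim_rootP prim_ze (x := s (z e)); last by exists i.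
by rewrite -rmorphXn (prim_expr_order prim_ze) rmorph1.
Qed.

Lemma abelian_gal : abelian 'Gal(E / 1)%g.
Proof.
apply/centsP=> s _ t _; apply: gal_eq; rewrite !galM ?mem_adjF //.
have [[i Ds] [k Dt]] := (gal_root_pow s, gal_root_pow t).
by rewrite Ds Dt !rmorphXn /= Ds Dt -!exprM mulnC.
Qed.

(** The order is the degree over F, a product of factors 1 or 2 along the fields [Fzeta z k]. *)
Lemma pgroup_gal : (2.-group 'Gal(E / 1))%g.
Proof.
rewrite /pgroup -(galois_dim galois_Fzeta) dimv1 divn1.
have: forall k, (k <= e)%N -> (2.-nat (\dim (Fzeta z k)))%N; last exact.
elim=> [|k IHk] lt_ke.
  suff ->: Fzeta z 0 = 1%AS by rewrite /= dimv1.
  have [/prim_expr_order] := zP lt_ke; rewrite expr1 => z0 _.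
  by apply/val_inj/Fadjoin_idP; rewrite z0 mem1v.
have sqr_zk := root_chain_sqr zP lt_ke.
have sEk: (Fzeta z k <= Fzeta z k.+1)%VS.
  by rewrite sub_adjF -sqr_zk rpredX ?mem_adjF.
rewrite /Fzeta (adjF_sup sEk) dim_Fadjoin pnatM IHk ?(ltnW lt_ke) // andbT.
have := @adjoin_degree_le2 _ _ (Fzeta z k) (z k.+1) 0 (z k) (mem0v _) (mem_adjF _).
rewrite mul0r add0r => /(_ sqr_zk).
by case: adjoin_degree (isT : 0 < adjoin_degree (Fzeta z k) (z k.+1))%N => [|[|[]]].
Qed.

(** [s] raises [z e] to a power i with i^2 = 1 modulo 2^e. Such an i is odd, and i = 2a + 1 gives
    2^(e-2) | a(a + 1). The odd one of a, a + 1 is coprime to 2^(e-2), so the other is a multiple of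
    it, and twice that one is an exponent giving 1 or -1. *)
Lemma gal_involution s : s (s (z e)) = z e ->
  s (z e) \in [:: z e; - z e; (z e)^-1; - (z e)^-1].
Proof.
have [prim_ze _] := zP (leqnn e); have z0 := root_chain_neq0 zP (leqnn e).
have [i Ds] := gal_root_pow s; rewrite {1}Ds rmorphXn /= Ds -exprM => /eqP.
have De: (2 ^ e = 4 * 2 ^ (e - 2))%N by rewrite -(expnD 2 2) subnKC.
have DE: (2 ^ e = 2 * 2 ^ (e - 1))%N by rewrite -(expnD 2 1) subnKC.
have odd_i: z e ^+ (i * i) == z e -> odd i.
  rewrite -{2}(expr1 (z e)) (eq_prim_root_expr prim_ze) => /eqP eq1.
  have: (i * i = 1 %[mod 2])%N.
    have d2: (2 %| 2 ^ e)%N by rewrite DE dvdn_mulr.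
    by rewrite -(modn_dvdm (i * i) d2) eq1 modn_dvdm.
  by rewrite !modn2 oddM; case: (odd i).
move=> eq1; have := odd_double_half i; rewrite odd_i // add1n.
move: i./2 => a Di; move: eq1; rewrite -Di.
rewrite -{2}(expr1 (z e)) (eq_prim_root_expr prim_ze) eqn_mod_dvd //.
have ->: (a.*2.+1 * a.*2.+1 - 1 = 4 * (a * a.+1))%N by lia.
rewrite De dvdn_pmul2l // => dvd_a.
have sqr1 b: (2 ^ (e - 2) %| b)%N -> (z e ^+ b.*2 == 1) || (z e ^+ b.*2 == -1).
  rewrite -(dvdn_pmul2l (isT : 0 < 4)%N) -De (prim_order_dvd prim_ze).
  have ->: (4 * b = b.*2 * 2)%N by lia.
  by rewrite exprM -{1}(expr1n _ 2) eqf_sqr.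
rewrite !inE; case/boolP: (odd a) => odd_a.
  rewrite Gauss_dvdr ?coprimeXl ?coprime2n // in dvd_a.
  have: z e ^+ a.+1.*2 = z e ^+ a.*2.+1 * z e by rewrite -exprSr doubleS.
  case/orP: (sqr1 _ dvd_a) => /eqP-> Dz; apply/or4P.
    by apply: Or43; rewrite -[X in X == _](mulfK z0) -Dz mul1r.
  by apply: Or44; rewrite -[X in X == _](mulfK z0) -Dz mulN1r.
rewrite Gauss_dvdl ?coprimeXl ?coprime2n //= ?odd_a // in dvd_a.
by rewrite exprS; case/orP: (sqr1 _ dvd_a) => /eqP->;
  rewrite ?mulr1 ?mulrN1 eqxx ?orbT.
Qed.

(** There is an elementary abelian subgroup of order 4. If nothing inverted [z e], its four elements
    would take distinct values at [z e] among only three candidates. *)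
Lemma noncyclic_conj :
  ~~ cyclic 'Gal(E / 1)%g -> exists s, s (z e) = (z e)^-1.
Proof.
rewrite (abelian_rank1_cyclic abelian_gal) -ltnNge (rank_pgroup pgroup_gal).
case/p_rank_geP=> A EA; have cardA := card_pnElem EA.
have [_ abelA _] := pnElemP EA; have [_ A2] := abelemP (isT : prime 2) abelA.
apply/exists_eqP; apply: contraT; rewrite negb_exists => /forallP noV.
pose r := [seq s (z e) | s in A].
have Ur: uniq r by rewrite map_inj_uniq ?enum_uniq //; apply: gal_eq.
have: (size r <= size [:: z e; - z e; - (z e)^-1])%N.
  apply: uniq_leq_size Ur _ => _ /imageP[s As ->].
  have := @gal_involution s; rewrite -galM ?mem_adjF // (A2 s As : s * s = 1)%g.
  by rewrite gal_id => /(_ erefl); rewrite !inE (negPf (noV s)).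
by rewrite size_image cardA.
Qed.

Lemma gal_fix1 s x : x \in 1%VS -> s x = x.
Proof. exact/fixed_gal/mem_gal1/sub1v. Qed.

Lemma gal_fix_root_le s k m : (k <= m <= e)%N -> s (z m) = z m -> s (z k) = z k.
Proof.
case/andP=> /subnKC <- le_me sm.
by rewrite -{1}(root_chainX zP le_me) rmorphXn /= sm (root_chainX zP).
Qed.

Lemma root2_sqr : z 2 ^+ 2 = -1.
Proof. by rewrite (root_chain_sqr zP) ?(root_chain1 zP). Qed.

(** * Automorphisms negating or inverting roots above level n *)

Section Generic.

Variable n : nat.
Hypotheses (n_gt1 : (1 < n)%N) (lt_ne : (n < e)%N).
Hypothesis z2_notin : z 2 \notin 1%VS.
Hypothesis zn_plus : z n + (z n)^-1 \in 1%VS.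
Hypothesis zn1_plus : z n.+1 + (z n.+1)^-1 \notin 1%VS.
Hypothesis zn1_minus : z n.+1 - (z n.+1)^-1 \notin 1%VS.

Lemma gal_root_n s : s (z n) = z n \/ s (z n) = (z n)^-1.
Proof.
have zn0 := root_chain_neq0 zP (ltnW lt_ne).
have := gal_fix1 s zn_plus; rewrite rmorphD fmorphV /= => /esym.
by apply: addV_inj; rewrite ?fmorph_eq0.
Qed.

(* An automorphism sends w = z n.+1 to w, 1/w, -w or -1/w. One moving w + 1/w
   sends w to -w or -1/w, one moving w - 1/w sends w to -w or 1/w; inverting and
   then applying w |-> -1/w negates w. *)
Lemma gal_opp_base : exists t, t (z n.+1) = - z n.+1.
Proof.
set w := z n.+1; have w0: w != 0 by apply: (root_chain_neq0 zP).
have [Ep Em] := mem_Fzeta_pm lt_ne.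
have sqw s: s w = w \/ s w = - w \/ s w = w^-1 \/ s w = - w^-1.
  have: s w ^+ 2 = w ^+ 2 \/ s w ^+ 2 = w^-1 ^+ 2.
    by rewrite -rmorphXn /= exprVn /w (root_chain_sqr zP) //; apply: gal_root_n.
  case=> /eqP; rewrite eqf_sqr => /orP[]/eqP; auto.
have [a _] := gal_moves (sub1v _) Ep zn1_plus.
have [b _] := gal_moves (sub1v _) Em zn1_minus.
rewrite -/w rmorphB rmorphD !fmorphV /=.
case: (sqw b) => [-> | [Db _ _| [Db _|->]]]; [by rewrite eqxx | by exists b | |].
  case: (sqw a) => [-> | [Da _| [->|Da _]]]; [by rewrite eqxx | by exists a | |].
    by rewrite invrK addrC eqxx.
  exists (b * a)%g; rewrite galM ?mem_Fzeta //; rewrite -/w Db fmorphV /= Da.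
  by rewrite invrN invrK.
by rewrite invrN invrK opprK addrC eqxx.
Qed.

Lemma gal_opp m : (n <= m < e)%N -> exists t, t (z m.+1) = - z m.+1.
Proof.
case/andP; elim: m => [|m IHm].
  by move=> n_le0; have := leq_trans n_gt1 n_le0.
rewrite leq_eqVlt => /predU1P[<- _|lt_nm lt_me]; first exact: gal_opp_base.
(* [t] sends [z m.+2] to plus or minus [z 2 * z m.+2] and fixes [z 2], as m >= 2; so applying [t]
   twice multiplies [z m.+2] by [z 2 ^+ 2], which is -1. *)
have [t Dt] := IHm lt_nm (ltnW lt_me); exists (t * t)%g.
have t2: t (z 2) = z 2.
  apply: (gal_fix_root_le (m := m)); first by lia.
  by rewrite -(root_chain_sqr zP (ltnW lt_me)) rmorphXn /= Dt sqrrN.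
rewrite galM ?mem_Fzeta //.
have: t (z m.+2) ^+ 2 = (z 2 * z m.+2) ^+ 2.
  by rewrite -rmorphXn /= exprMn root2_sqr (root_chain_sqr zP lt_me) Dt mulN1r.
move/eqP; rewrite eqf_sqr => /orP[]/eqP Dv.
  by rewrite Dv rmorphM /= t2 Dv mulrA -expr2 root2_sqr mulN1r.
by rewrite Dv rmorphN rmorphM /= t2 Dv mulrN opprK mulrA -expr2 root2_sqr mulN1r.
Qed.

(** At level n, an automorphism moving [z n] must invert it, and one exists because [z 2], a power
    of [z n], is outside F. Higher up, inversion lifts up to a sign, which [gal_opp] corrects. *)
Lemma gal_conj m : (n <= m <= e)%N -> exists s, s (z m) = (z m)^-1.
Proof.
case/andP; elim: m => [|m IHm].
  by move=> n_le0; have := leq_trans n_gt1 n_le0.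
rewrite leq_eqVlt => /predU1P[<- _|lt_nm lt_me].
  have: z n \notin 1%VS.
    apply: contra z2_notin => zn1.
    by rewrite -(root_chainX zP (m := n - 2)) subnKC ?rpredX // ltnW.
  case/(gal_moves (sub1v _) (mem_Fzeta (ltnW lt_ne))) => s _.
  by case: (gal_root_n s) => [->|]; [rewrite eqxx | exists s].
have [s Ds] := IHm lt_nm (ltnW lt_me).
have: s (z m.+1) ^+ 2 = (z m.+1)^-1 ^+ 2.
  by rewrite -rmorphXn /= exprVn (root_chain_sqr zP lt_me).
move/eqP; rewrite eqf_sqr => /orP[]/eqP Dw; first by exists s.
have [|t Dt] := @gal_opp m; first by apply/andP.
exists (s * t)%g; rewrite galM ?mem_Fzeta // Dw rmorphN fmorphV /= Dt.
by rewrite invrN opprK.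
Qed.

End Generic.

(** * The Klein four-group and the index 2 subfields *)

Section Klein.

Variables s t : gal_of E.
Hypotheses (Ds : s (z e) = (z e)^-1) (Dt : t (z e) = - z e).

Let ze0 : z e != 0. Proof. exact: (root_chain_neq0 zP). Qed.
Let Eze : z e \in E. Proof. exact: mem_adjF. Qed.
Let lt_e1 : (e.-1 < e)%N. Proof. by rewrite prednK. Qed.
Let sqr_ze : z e ^+ 2 = z e.-1.
Proof. by rewrite -(root_chain_sqr zP lt_e1) prednK. Qed.

Let addV_neq0 : z e + (z e)^-1 != 0.
Proof.
have := root_chain_neqNV zP (k := e); rewrite e_gt2 leqnn => /(_ isT).
by apply: contra; rewrite addr_eq0 eq_sym.
Qed.

Let subV_neq0 : z e - (z e)^-1 != 0.
Proof.
have := root_chain_neqV zP (k := e); rewrite e_gt1 leqnn => /(_ isT).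
by rewrite subr_eq0 eq_sym.
Qed.

(** The involutions [t], [s] and [s * t] fix z_{e-1}, z_e + 1/z_e and z_e - 1/z_e respectively, the
    generators of the three index 2 subfields. *)
Let Dst : (s * t)%g (z e) = - (z e)^-1.
Proof. by rewrite galM // Ds fmorphV /= Dt invrN. Qed.

Let t_plus : t (z e + (z e)^-1) != z e + (z e)^-1.
Proof.
rewrite rmorphD fmorphV /= Dt invrN -opprD.
exact: (root_chain_oppr_neq zP e_gt0 addV_neq0).
Qed.

Let t_minus : t (z e - (z e)^-1) != z e - (z e)^-1.
Proof.
rewrite rmorphB fmorphV /= Dt invrN -opprD.
exact: (root_chain_oppr_neq zP e_gt0 subV_neq0).
Qed.

Let t_pred : t (z e.-1) = z e.-1.
Proof. by rewrite -sqr_ze rmorphXn /= Dt sqrrN. Qed.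

Let s_plus : s (z e + (z e)^-1) = z e + (z e)^-1.
Proof. by rewrite rmorphD fmorphV /= Ds invrK addrC. Qed.

Let st_minus : (s * t)%g (z e - (z e)^-1) = z e - (z e)^-1.
Proof. by rewrite rmorphB fmorphV /= Dst invrN invrK opprK addrC. Qed.

Lemma index2_Fzeta_Fplus : index2 E (Fplus z e).
Proof.
have [Ep _] := mem_Fzeta_pm (leqnn e).
apply: (@index2_adjF _ _ _ _ (z e + (z e)^-1) (-1)).
- apply: gal_notin s_plus _; rewrite // Ds.
  by have := root_chain_neqV zP (k := e); rewrite e_gt1 leqnn; apply.
- by rewrite sub_adjF.
- exact: mem_adjF.
- by rewrite rpredN1.
by field.
Qed.

Lemma index2_Fzeta_Fminus : index2 E (Fminus z e).
Proof.
have [_ Em] := mem_Fzeta_pm (leqnn e).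
apply: (@index2_adjF _ _ _ _ (z e - (z e)^-1) 1).
- apply: gal_notin st_minus _; rewrite // Dst.
  by have := root_chain_neqNV zP (k := e); rewrite e_gt2 leqnn; apply.
- by rewrite sub_adjF.
- exact: mem_adjF.
- exact: mem1v.
by field.
Qed.

Lemma index2_Fzeta_pred : index2 E (Fzeta z e.-1).
Proof.
apply: (@index2_adjF _ _ _ _ 0 (z e.-1)).
- apply: gal_notin t_pred _; rewrite ?mem_Fzeta ?leq_pred // Dt.
  exact: (root_chain_oppr_neq zP e_gt0 ze0).
- by rewrite sub_adjF mem_Fzeta ?leq_pred.
- exact: mem0v.
- exact: mem_adjF.
by rewrite mul0r add0r.
Qed.

Lemma index2_Fplus_pred : index2 (Fplus z e) (Fplus z e.-1).
Proof.
have sqr: (z e + (z e)^-1) ^+ 2 = z e.-1 + (z e.-1)^-1 + 2.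
  by rewrite -sqr_ze; field.
have [Ep _] := mem_Fzeta_pm (leq_pred e).
apply: (@index2_adjF _ _ _ _ 0 (z e.-1 + (z e.-1)^-1 + 2)).
- by apply: (gal_notin (s := t)) => //; rewrite rmorphD fmorphV /= t_pred.
- rewrite sub_adjF -[_ + _](addrK 2) -sqr rpredB ?rpredX ?mem_adjF //.
  by rewrite rpred_nat.
- exact: mem0v.
- by rewrite rpredD ?mem_adjF ?rpred_nat.
by rewrite mul0r add0r.
Qed.

Lemma index2_Fminus_pred : index2 (Fminus z e) (Fplus z e.-1).
Proof.
have sqr: (z e - (z e)^-1) ^+ 2 = z e.-1 + (z e.-1)^-1 - 2.
  by rewrite -sqr_ze; field.
have [Ep _] := mem_Fzeta_pm (leq_pred e).
apply: (@index2_adjF _ _ _ _ 0 (z e.-1 + (z e.-1)^-1 - 2)).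
- by apply: (gal_notin (s := t)) => //; rewrite rmorphD fmorphV /= t_pred.
- rewrite sub_adjF -[_ + _](subrK 2) -sqr rpredD ?rpredX ?mem_adjF //.
  by rewrite rpred_nat.
- exact: mem0v.
- by rewrite rpredB ?mem_adjF ?rpred_nat.
by rewrite mul0r add0r.
Qed.

Lemma uniq_index2_Fzeta : uniq [:: Fzeta z e.-1; Fplus z e; Fminus z e].
Proof.
have Epred: z e.-1 \in E by rewrite mem_Fzeta ?leq_pred.
have [Ep _] := mem_Fzeta_pm (leqnn e).
rewrite /= !inE negb_or !andbT -andbA; apply/and3P; split.
- have := gal_notin Epred t_pred t_plus; apply: contra => /eqP eqE.
  by rewrite -/(Fzeta z e.-1) eqE mem_adjF.
- have := gal_notin Epred t_pred t_minus; apply: contra => /eqP eqE.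
  by rewrite -/(Fzeta z e.-1) eqE mem_adjF.
have: s (z e - (z e)^-1) != z e - (z e)^-1.
  rewrite rmorphB fmorphV /= Ds invrK -opprB.
  exact: (root_chain_oppr_neq zP e_gt0 subV_neq0).
move/(gal_notin Ep s_plus); apply: contra => /eqP eqPM.
by rewrite -/(Fplus z e) eqPM mem_adjF.
Qed.

Let s_neq1 : s != 1%g.
Proof.
apply: contraTneq (root_chain_neqV zP (k := e) _) => [s1|].
  by rewrite -Ds s1 gal_id eqxx.
by rewrite e_gt1 leqnn.
Qed.

Let t_neq1 : t != 1%g.
Proof.
apply: contraNneq (root_chain_oppr_neq zP e_gt0 ze0) => t1.
by rewrite -Dt t1 gal_id eqxx.
Qed.

Let st_neq : s != t.
Proof.
apply: contraNneq t_plus => <-; exact/eqP.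
Qed.

Let ord_s : #[s]%g = 2%N.
Proof.
apply: nt_prime_order => //; apply: gal_eq.
by rewrite gal_id galM // Ds fmorphV /= Ds invrK.
Qed.

Let ord_t : #[t]%g = 2%N.
Proof.
apply: nt_prime_order => //; apply: gal_eq.
by rewrite gal_id galM // Dt rmorphN /= Dt opprK.
Qed.

Lemma card_klein : #|<<[set s; t]>>%g| = 4%N.
Proof.
have ->: <<[set s; t]>>%g = (<[s]> <*> <[t]>)%g.
  by rewrite joing_idl joing_idr.
rewrite cent_joinEr; last first.
  rewrite (sub_abelian_cent2 abelian_gal) //.
    by rewrite cycle_subG mem_gal1.
  by rewrite cycle_subG mem_gal1.
rewrite TI_cardMg -?orderE ?ord_s ?ord_t //.
apply: prime_TIg; rewrite -?orderE ?ord_s //.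
by rewrite cycle_subG /= cycle2g // !inE negb_or s_neq1.
Qed.

(** A cyclic group has at most one subgroup of each order, but [<[s]>] and [<[t]>] are distinct of
    order 2. *)
Lemma noncyclic_klein : ~~ cyclic 'Gal(E / 1)%g.
Proof.
apply/negP=> /(@eq_subG_cyclic _ _ <[s]> <[t]>).
rewrite !cycle_subG !mem_gal1 -!orderE ord_s ord_t => /(_ isT isT).
rewrite eqxx => /eqP eq_st; have: s \in <[t]>%g by rewrite -eq_st cycle_id.
by rewrite cycle2g // !inE (negPf s_neq1) (negPf st_neq).
Qed.

(** The group of [M] is {1, g} with g moving [z e], and [gal_involution] leaves three possible g.
    Each fixes the generator of one listed field, which then equals [M] because both have index
    2. *)
Lemma index2_FzetaP M :
  index2 E M <-> M \in [:: Fzeta z e.-1; Fplus z e; Fminus z e].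
Proof.
split=> [iEM|]; last first.
  rewrite !inE => /or3P[]/eqP->.
  - exact: index2_Fzeta_pred.
  - exact: index2_Fzeta_Fplus.
  exact: index2_Fzeta_Fminus.
have sME := index2_sub iEM.
have galME: galois M E by apply: galoisS galois_Fzeta; rewrite sub1v.
have cardM: #|'Gal(E / M)%g| = 2%N.
  by rewrite -(galois_dim galME); case/andP: iEM => _ /eqP.
have M'ze := index2_notin iEM.
have [g Mg gze] := gal_moves sME Eze M'ze.
have g2: (g * g = 1)%g by rewrite -[RHS](expg_cardG Mg) cardM.
have defG: 'Gal(E / M)%g = [set 1; g]%g.
  have g1: 1%g != g by apply: contraNneq gze => <-; rewrite gal_id.
  by apply/esym/eqP; rewrite eqEcard subUset !sub1set group1 Mg cardM cards2 g1.
have eqM x: x \in E -> g x = x -> index2 E (adjF x) -> M = adjF x.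
  move=> Ex gx iEx; apply/esym/(index2_inj iEx iEM); rewrite sub_adjF.
  rewrite -(galois_fixedField galME) defG; apply/fixedFieldP=> //.
  by move=> h /set2P[]->; rewrite ?gal_id.
have := @gal_involution g; rewrite -galM //= g2 gal_id.
have [Ep Em] := mem_Fzeta_pm (leqnn e).
move=> /(_ erefl); rewrite !inE (negPf gze) /= => /or3P[]/eqP Dg; apply/or3P.
- apply: Or31; apply/eqP/eqM; last exact: index2_Fzeta_pred.
    by rewrite mem_Fzeta ?leq_pred.
  by rewrite -sqr_ze rmorphXn /= Dg sqrrN.
- apply: Or32; apply/eqP/eqM; last exact: index2_Fzeta_Fplus.
    by [].
  by rewrite rmorphD fmorphV /= Dg invrK addrC.
apply: Or33; apply/eqP/eqM; last exact: index2_Fzeta_Fminus.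
  by [].
by rewrite rmorphB fmorphV /= Dg invrN invrK opprK addrC.
Qed.

(** As e > 2, [z 2] is a power of [z e ^+ 2], where the sign has disappeared; so [h] inverts [z 2],
    whose inverse is its opposite. *)
Lemma gal_conj_sign_root2 (h : gal_of E) :
  h (z e) = (z e)^-1 \/ h (z e) = - (z e)^-1 -> h (z 2) = - z 2.
Proof.
move=> Dh; have hpred: h (z e.-1) = (z e.-1)^-1.
  by rewrite -sqr_ze rmorphXn /= -exprVn; case: Dh => ->; rewrite ?sqrrN.
have le2e: (2 + (e.-1 - 2) <= e)%N by lia.
have De: (2 + (e.-1 - 2) = e.-1)%N by lia.
rewrite -{1}(root_chainX zP le2e) De rmorphXn /= hpred exprVn.
rewrite -{1}De (root_chainX zP) //.
have z20: z 2 != 0 by apply: (root_chain_neq0 zP).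
by apply: (mulfI z20); rewrite mulfV // mulrN -expr2 root2_sqr opprK.
Qed.

Lemma gal_sqr_root2 (h : gal_of E) : h (h (z 2)) = z 2.
Proof.
have: h (z 2) ^+ 2 = z 2 ^+ 2 by rewrite -rmorphXn /= root2_sqr rmorphN1.
move/eqP; rewrite eqf_sqr => /orP[]/eqP Dh; rewrite !Dh //.
by rewrite rmorphN /= Dh opprK.
Qed.

(* Squares fix z 2 = sqrt(-1) while g does not, so the group Gal(E / M) of order 4
   contains g but is not cyclic with g as its square; hence it contains t. *)
Lemma index2_index2_Fzeta (Q M : {subfield L}) (g : gal_of E) :
    g \in 'Gal(E / Q)%g -> g (z e) = (z e)^-1 \/ g (z e) = - (z e)^-1 ->
    index2 E Q -> index2 Q M -> index2 Q (Fplus z e.-1) ->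
  M = Fplus z e.-1.
Proof.
move=> Qg Dg iEQ iQM iQP; have [sQE sMQ] := (index2_sub iEQ, index2_sub iQM).
have sME := subv_trans sMQ sQE.
have galME: galois M E by apply: galoisS galois_Fzeta; rewrite sub1v.
have cardM: #|'Gal(E / M)%g| = 4%N.
  rewrite -(galois_dim galME) (index2_dim iEQ) (index2_dim iQM) mulnA.
  by rewrite mulnK ?adim_gt0.
have Mg: g \in 'Gal(E / M)%g by apply: (subsetP (galS E sMQ)).
have z2N: z 2 != - z 2.
  by rewrite eq_sym (root_chain_oppr_neq zP) // (root_chain_neq0 zP).
have Mt: t \in 'Gal(E / M)%g.
  have [h Mh]: exists2 h, h \in 'Gal(E / M)%g & h \notin [set 1; g]%g.
    apply/subsetPn; apply/negP=> /subset_leq_card; rewrite cardM cards2.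
    by case: (_ != _).
  rewrite !inE negb_or => /andP[h1 hg].
  have ht: (h * h)%g (z e) = - z e -> t \in 'Gal(E / M)%g.
    by rewrite -Dt => /gal_eq <-; rewrite groupM.
  have h4: (h * h)%g ((h * h)%g (z e)) = z e.
    have h4: (h * (h * (h * h)) = 1)%g by rewrite -[RHS](expg_cardG Mh) cardM.
    by rewrite -galM // -!mulgA h4 gal_id.
  have h2z2: (h * h)%g (z 2) = z 2 by rewrite galM ?mem_Fzeta // gal_sqr_root2.
  (* [h * h] fixes [z 2], so it is [t] or 1. If it is 1, then [h] is [t], or [h] is the one of z |->
     1/z, z |-> -1/z other than [g], and [g * h] is [t]. *)
  have := gal_involution h4; rewrite !inE => /or4P[]/eqP Dh2; last 1 first.
  - by rewrite (gal_conj_sign_root2 (or_intror Dh2)) in h2z2; case/eqP: z2N.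
  - rewrite galM // in Dh2; have := gal_involution Dh2.
    rewrite !inE => /or4P[]/eqP Dh.
    + by case/eqP: h1; apply: gal_eq; rewrite gal_id.
    + by rewrite (_ : t = h) //; apply: gal_eq; rewrite Dt.
    + case: Dg => Dg; first by case/eqP: hg; apply: gal_eq; rewrite Dg.
      rewrite (_ : t = g * h)%g ?groupM //; apply: gal_eq.
      by rewrite Dt galM // Dg rmorphN fmorphV /= Dh invrK.
    case: Dg => Dg; last by case/eqP: hg; apply: gal_eq; rewrite Dg.
    rewrite (_ : t = g * h)%g ?groupM //; apply: gal_eq.
    by rewrite Dt galM // Dg fmorphV /= Dh invrN invrK.
  - exact: ht.
  by rewrite (gal_conj_sign_root2 (or_introl Dh2)) in h2z2; case/eqP: z2N.
have Ms: s \in 'Gal(E / M)%g.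
  case: Dg => Dg; first by rewrite (_ : s = g) //; apply: gal_eq; rewrite Ds.
  rewrite (_ : s = g * t)%g ?groupM //; apply: gal_eq.
  by rewrite Ds galM // Dg rmorphN fmorphV /= Dt invrN opprK.
have [Ep _] := mem_Fzeta_pm (leq_pred e).
have sPE: (Fplus z e.-1 <= E)%VS by rewrite sub_adjF.
apply/esym/(index2_inj iQP iQM).
(* Gal(E / M) is now the whole four-group of [s] and [t], which both fix z_{e-1} + 1/z_{e-1}; so [M]
   contains [Fplus z e.-1]. *)
rewrite -(galois_fixedField galME) -galois_connection //.
have <-: <<[set s; t]>>%g = 'Gal(E / M)%g.
  apply/eqP; rewrite eqEcard card_klein cardM leqnn gen_subG subUset.
  by rewrite !sub1set Ms Mt.
rewrite gen_subG subUset !sub1set; apply/andP; split; apply: mem_gal_adjF => //.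
  by rewrite rmorphD fmorphV /= -sqr_ze rmorphXn /= Ds !exprVn invrK addrC.
by rewrite rmorphD fmorphV /= t_pred.
Qed.

Lemma index2_FplusP M : index2 (Fplus z e) M <-> M = Fplus z e.-1.
Proof.
split=> [iPM|->]; last exact: index2_Fplus_pred.
have [Ep _] := mem_Fzeta_pm (leqnn e).
apply: index2_index2_Fzeta iPM index2_Fplus_pred; last exact: index2_Fzeta_Fplus.
  exact: mem_gal_adjF s_plus.
by left.
Qed.

Lemma index2_FminusP M : index2 (Fminus z e) M <-> M = Fplus z e.-1.
Proof.
split=> [iPM|->]; last exact: index2_Fminus_pred.
have [_ Em] := mem_Fzeta_pm (leqnn e).
apply: index2_index2_Fzeta iPM index2_Fminus_pred; last exact: index2_Fzeta_Fminus.
  exact: mem_gal_adjF st_minus.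
by right.
Qed.

End Klein.

End CyclotomicGalois.

(** * Enumeration of the 2-towers *)

Lemma downtoS n m : (m <= n.+1)%N -> downto n.+1 m = n.+1 :: downto n m.
Proof.
move=> le_mn; rewrite /downto subSn // -addn1 iotaD /= subnKC // cats1.
exact: rev_rcons.
Qed.

Lemma downto_nil n m : (n < m)%N -> downto n m = [::].
Proof. by rewrite /downto -subn_eq0 => /eqP->. Qed.

Section Towers.

Variables (F : fieldType) (L : splittingFieldType F) (z : nat -> L) (n e : nat).
Hypothesis zP : root_chain z e.
Hypotheses (n_gt1 : (1 < n)%N) (lt_ne : (n < e)%N).
Hypothesis z2_notin : z 2 \notin 1%VS.
Hypothesis zn_plus : z n + (z n)^-1 \in 1%VS.
Hypothesis zn1_plus : z n.+1 + (z n.+1)^-1 \notin 1%VS.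
Hypothesis zn1_minus : z n.+1 - (z n.+1)^-1 \notin 1%VS.
Implicit Types (K M : {subfield L}) (t : seq {subfield L}).

(** The group is that of F(z k): truncating the chain at [k] makes the Klein analysis available at
    every level above n. *)
Lemma exists_klein k : (n < k <= e)%N ->
  exists u v : gal_of (Fzeta z k), u (z k) = (z k)^-1 /\ v (z k) = - z k.
Proof.
case/andP=> lt_nk le_ke; have zPk := root_chainS zP le_ke.
have k_gt2: (2 < k)%N by apply: leq_trans lt_nk.
have [u Du] : exists u : gal_of (Fzeta z k), u (z k) = (z k)^-1.
  by apply: (gal_conj zPk k_gt2 n_gt1); rewrite // ?(ltnW lt_nk) ?leqnn.
have [v Dv] : exists v : gal_of (Fzeta z k), v (z k.-1.+1) = - z k.-1.+1.
  by apply: (gal_opp zPk k_gt2 n_gt1) => //; lia.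
by exists u, v; rewrite prednK // in Dv; lia.
Qed.

Lemma Fplus_base : Fplus z n = 1%AS.
Proof. exact/val_inj/Fadjoin_idP. Qed.

Lemma index2_Fzeta_base M : index2 (Fzeta z n) M <-> M = 1%AS.
Proof.
have zn0: z n != 0 by apply: (root_chain_neq0 zP (ltnW lt_ne)).
have iE1: index2 (Fzeta z n) 1%AS.
  apply: (index2_adjF (a := z n + (z n)^-1) (b := -1)) => //.
  - apply: contra z2_notin => zn1.
    by rewrite -(root_chainX zP (m := n - 2)) subnKC ?rpredX // ltnW.
  - exact: sub1v.
  - by rewrite rpredN1.
  by field.
split=> [iEM|-> //]; apply/esym/(index2_inj iE1 iEM)/sub1v.
Qed.

(** [t] lists what follows the top field [K], so that a step down removes the head of [t]. *)
Definition tower_below K t := path (@index2 _ _) K t && (last K t == 1%AS).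

Lemma two_towerE K t :
  two_tower K t = if t is K' :: t' then (K' == K) && tower_below K t' else false.
Proof.
by case: t => //= K' t; case: eqP => // ->.
Qed.

Lemma tower_below1 t : tower_below 1%AS t = (t == [::]).
Proof. by rewrite /tower_below; case: t => [|M t] /=; rewrite ?eqxx ?index2_1. Qed.

(** The existence of [M] shows that [K] is not F, so [t] cannot be empty. *)
Lemma tower_below_index2 K M t : index2 K M ->
  tower_below K t ->
  exists K' t', [/\ t = K' :: t', index2 K K' & tower_below K' t'].
Proof.
move=> iKM; case: t => [|K' t] /=; rewrite /tower_below /=.
  by move/eqP=> K1; rewrite K1 index2_1 in iKM.
by case/andP=> /andP[iKK' pt] lt; exists K', t; rewrite pt.
Qed.

Lemma tower_below_cons K M t :
  tower_below K (M :: t) = index2 K M && tower_below M t.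
Proof. by rewrite /tower_below /= andbA. Qed.

(** There is no choice: [Fplus z k] has the single index 2 subfield [Fplus z k.-1]. The list stops
    at n + 1 because [Fplus z n] is already F. *)
Lemma tower_below_Fplus k t : (n < k <= e)%N ->
  tower_below (Fplus z k) t <-> t = map (Fplus z) (downto k.-1 n.+1) ++ [:: 1%AS].
Proof.
elim: k t => // k IHk t /andP[lt_nk le_ke].
have [|u [v [Du Dv]]] := @exists_klein k.+1; first by rewrite lt_nk.
have k_gt2: (2 < k.+1)%N by lia.
have iP := index2_FplusP (root_chainS zP le_ke) k_gt2 Du Dv.
have iPk: index2 (Fplus z k.+1) (Fplus z k) by apply/iP.
have step: tower_below (Fplus z k.+1) t <->
    exists2 t', t = Fplus z k :: t' & tower_below (Fplus z k) t'.
  split=> [/(tower_below_index2 iPk)[K [t' [-> /iP -> ?]]]|[t' ->]].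
    by exists t'.
  by rewrite tower_below_cons iPk.
rewrite step /=; move: lt_nk; rewrite ltnS leq_eqVlt.
case/predU1P=> [<- | lt_nk]; last first.
  have IH t' := IHk t' (introT andP (conj lt_nk (ltnW le_ke))).
  case: k lt_nk IH {IHk step iP iPk Du Dv k_gt2 u v le_ke} => // k lt_nk IH.
  rewrite downtoS //=; split=> [[t' -> /IH -> //]|->].
  by eexists; [reflexivity | apply/IH].
rewrite Fplus_base downto_nil //=; split=> [[t' ->]|->].
  by rewrite tower_below1 => /eqP->.
by exists [::]; rewrite ?tower_below1.
Qed.

(** [Fminus z k] and [Fplus z k] have the same unique index 2 subfield, hence the same
    continuations. *)
Lemma tower_below_Fminus k t : (n < k <= e)%N ->
  tower_below (Fminus z k) t <-> t = map (Fplus z) (downto k.-1 n.+1) ++ [:: 1%AS].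
Proof.
move=> kP; rewrite -(tower_below_Fplus t kP); case/andP: (kP) => lt_nk le_ke.
have [u [v [Du Dv]]] := exists_klein kP.
have k_gt2: (2 < k)%N by lia.
have iP := index2_FplusP (root_chainS zP le_ke) k_gt2 Du Dv.
have iM := index2_FminusP (root_chainS zP le_ke) k_gt2 Du Dv.
have iPk: index2 (Fplus z k) (Fplus z k.-1) by apply/iP.
have iMk: index2 (Fminus z k) (Fplus z k.-1) by apply/iM.
split=> [/(tower_below_index2 iMk)[K [t' [-> /iM -> ?]]]|].
  by rewrite tower_below_cons iPk.
case/(tower_below_index2 iPk)=> [K [t' [-> /iP -> ?]]].
by rewrite tower_below_cons iMk.
Qed.

(** Under (5), nu and nu^+ coincide, hence the repeated [n]. *)
Let listed k := listed_towers z k n n.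

Lemma listed_base : listed n = [:: [:: Fzeta z n; 1%AS]].
Proof. by rewrite /listed /listed_towers /tower_a subnn /= /downto subSnn. Qed.

(** A tower from level k + 1 either leaves at once through [Fplus] or [Fminus], which is r = 0, or
    passes to level k, which lowers r by one. The families come in different orders on the two
    sides, hence [perm_eq]. *)
Lemma listedS k : (n <= k)%N ->
  perm_eq (listed k.+1)
    [:: tower_b z k.+1 n 0, tower_c z k.+1 n 0 &
        map (cons (Fzeta z k.+1)) (listed k)].
Proof.
move=> le_nk; rewrite /listed /listed_towers subSn //= -(addn0 1%N) !iotaDl.
have ->: tower_a z k.+1 n = Fzeta z k.+1 :: tower_a z k n.
  by rewrite /tower_a downtoS // leqW.
rewrite !map_cat -!map_comp.
set b0 := tower_b _ _ _ _; set c0 := tower_c _ _ _ _; set a := _ :: tower_a _ _ _.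
have eqb: map (tower_b z k.+1 n \o addn 1) (seq.iota 0 (k - n)) =
          map (cons (Fzeta z k.+1) \o tower_b z k n) (seq.iota 0 (k - n)).
  apply: eq_map => r /=; rewrite /tower_b add1n subSS downtoS //.
  by rewrite (leq_trans (leq_subr _ _)).
have eqc: map (tower_c z k.+1 n \o addn 1) (seq.iota 0 (k - n)) =
          map (cons (Fzeta z k.+1) \o tower_c z k n) (seq.iota 0 (k - n)).
  apply: eq_map => r /=; rewrite /tower_c add1n !subSS downtoS //.
  by rewrite (leq_trans (leq_subr _ _)).
rewrite eqb eqc; set B := map _ _; set C := map _ _.
by apply/seq.permP=> p; rewrite /= !count_cat /=; lia.
Qed.

Lemma size_listed k : size (listed k) = (2 * (k - n) + 1)%N.
Proof. by rewrite /= size_cat !size_map size_iota; lia. Qed.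

(** Induction on [k]: the second field of a tower is one of the three index 2 subfields, and these
    cases match [listedS]. *)
Lemma listed_towersP k : (n <= k <= e)%N ->
  uniq (listed k) /\ forall t, two_tower (Fzeta z k) t <-> t \in listed k.
Proof.
elim: k => [|k IHk] /andP[].
  by move=> n_le0; have := leq_trans n_gt1 n_le0.
rewrite leq_eqVlt => /predU1P[<- _ | lt_nk le_ke].
  rewrite listed_base; split=> // t; rewrite two_towerE inE.
  have iE1: index2 (Fzeta z n) 1%AS by apply/index2_Fzeta_base.
  split=> [|/eqP->]; last by rewrite eqxx tower_below_cons iE1 tower_below1.
  case: t => // K t /andP[/eqP->].
  case/(tower_below_index2 iE1)=> K' [t' [-> /index2_Fzeta_base->]].
  by rewrite tower_below1 => /eqP->.
have [|uniq_k towerP] := IHk; first by apply/andP; split; last exact: ltnW.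
have kP: (n < k.+1 <= e)%N by apply/andP.
have [u [v [Du Dv]]] := exists_klein kP.
have k_gt2: (2 < k.+1)%N by lia.
have zPk := root_chainS zP le_ke.
have iE := index2_FzetaP zPk k_gt2 Du Dv.
have [EP EM PM]: [/\ Fzeta z k != Fplus z k.+1, Fzeta z k != Fminus z k.+1
                   & Fplus z k.+1 != Fminus z k.+1].
  have := uniq_index2_Fzeta zPk k_gt2 Du Dv.
  by rewrite /= !inE negb_or => /and3P[/andP[]].
have Db: tower_b z k.+1 n 0 = [:: Fzeta z k.+1, Fplus z k.+1 &
    map (Fplus z) (downto k n.+1) ++ [:: 1%AS]].
  by rewrite /tower_b subn0 !downtoS //= /downto subnn.
have Dc: tower_c z k.+1 n 0 = [:: Fzeta z k.+1, Fminus z k.+1 &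
    map (Fplus z) (downto k n.+1) ++ [:: 1%AS]].
  by rewrite /tower_c subn0 subn1 downtoS //= /downto subnn.
have below_k t: t \in map (cons (Fzeta z k.+1)) (listed k) ->
    exists t', t = [:: Fzeta z k.+1, Fzeta z k & t'].
  case/mapP=> t' /towerP; rewrite two_towerE; case: t' => // K t'.
  by case/andP=> /eqP-> _ ->; exists t'.
have mem_listed := perm_mem (listedS lt_nk).
split.
  rewrite (perm_uniq (listedS lt_nk)) 2!cons_uniq.
  rewrite map_inj_uniq; last by move=> ? ? [].
  rewrite uniq_k inE negb_or andbT -andbA Db Dc; apply/and3P; split.
  (* The second entries tell the three kinds of towers apart; [1%AS] is the default value of
     [nth]. *)
  - by apply: contra PM => /eqP/(congr1 (nth 1%AS ^~ 1%N))/eqP.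
  - by apply: contra EP => /below_k[t' /(congr1 (nth 1%AS ^~ 1%N))] /= ->.
  by apply: contra EM => /below_k[t' /(congr1 (nth 1%AS ^~ 1%N))] /= ->.
move=> t; rewrite mem_listed two_towerE 2!inE Db Dc.
have iEk: index2 (Fzeta z k.+1) (Fzeta z k) by apply/iE; rewrite !inE eqxx.
split.
  case: t => // K t /andP[/eqP->].
  case/(tower_below_index2 iEk)=> K' [t' [-> /iE EK']].
  rewrite !inE in EK'; case/or3P: EK' => /eqP->.
  - move=> tw; apply/or3P/Or33/map_f/towerP; rewrite two_towerE eqxx.
    exact: tw.
  - by move/(tower_below_Fplus _ kP)=> /= ->; rewrite eqxx.
  by move/(tower_below_Fminus _ kP)=> /= ->; rewrite eqxx orbT.
case/or3P=> [/eqP->|/eqP->|/mapP[t' /towerP + ->]].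
- rewrite eqxx andTb tower_below_cons; apply/andP; split.
    by apply/iE; rewrite !inE eqxx orbT.
  exact/tower_below_Fplus.
- rewrite eqxx andTb tower_below_cons; apply/andP; split.
    by apply/iE; rewrite !inE eqxx !orbT.
  exact/tower_below_Fminus.
rewrite two_towerE eqxx; case: t' => // K t' /andP[/eqP-> tw].
by rewrite tower_below_cons iEk.
Qed.

End Towers.

(** * Powers of 5 and consequences of an inverting automorphism *)

Lemma pow5_2power m : exists q, (5 ^ (2 ^ m) = 1 + 2 ^ m.+2 * q.*2.+1)%N.
Proof.
elim: m => [|m [q Dq]]; first by exists 0%N.
(* With c = 2q + 1, the square of 1 + 2^(m+2) c is 1 + 2^(m+3) (c + 2^(m+1) c^2), and the last
   factor is again odd. *)
exists (q + 2 ^ m * (q.*2.+1 * q.*2.+1))%N.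
by rewrite expnSr expnM Dq !expnS; lia.
Qed.

Section GaloisConsequences.

Variables (F : fieldType) (L : splittingFieldType F) (z : nat -> L) (e : nat).
Hypothesis zP : root_chain z e.
Hypothesis e_gt2 : (2 < e)%N.

(** Identifies sigma_j for j = 5^(2^(e-3)) with z |-> -z: j is 1 plus an odd multiple of 2^(e-1). *)
Lemma root_pow5 : z e ^+ (5 ^ (2 ^ (e - 3))) = - z e.
Proof.
have [q ->] := pow5_2power (e - 3).
have ->: (e - 3).+2 = e.-1 by lia.
have z1: z e ^+ (2 ^ e.-1) = -1.
  have De: (1 + e.-1 = e)%N by lia.
  have := root_chainX zP (k := 1) (m := e.-1).
  by rewrite De (root_chain1 zP) => [->|] //; lia.
by rewrite exprS exprM z1 -signr_odd /= odd_double expr1 mulrN1.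
Qed.

(** An automorphism fixing z + 1/z and moving z inverts z; this is how (3) and (4) lead to (5). *)
Lemma index2_Fplus_conj : index2 (Fzeta z e) (Fplus z e) ->
  exists s : gal_of (Fzeta z e), s (z e) = (z e)^-1.
Proof.
move=> iEP; have ze0 := root_chain_neq0 zP (leqnn e).
have [s Ps] := gal_moves zP e_gt2 (index2_sub iEP) (mem_adjF _) (index2_notin iEP).
have := fixed_gal (index2_sub iEP) Ps (mem_adjF _).
rewrite rmorphD fmorphV /= => /esym/(addV_inj ze0).
by rewrite fmorph_eq0 => /(_ ze0)[->|]; [rewrite eqxx | exists s].
Qed.

Lemma conj_notin (s : gal_of (Fzeta z e)) k : s (z e) = (z e)^-1 ->
  (1 < k <= e)%N -> z 2 \notin 1%VS /\ z k - (z k)^-1 \notin 1%VS.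
Proof.
move=> Ds kP; have sV m: (m <= e)%N -> s (z m) = (z m)^-1.
  move=> le_me; have := root_chainX zP (k := m) (m := e - m).
  by rewrite subnKC // => <- //; rewrite rmorphXn /= Ds exprVn.
split; apply/negP=> /(gal_fix1 s).
  rewrite sV; last by lia.
  by apply/eqP/(root_chain_neqV zP); lia.
rewrite rmorphB fmorphV /= sV; last by lia.
rewrite invrK -opprB; apply/eqP/(root_chain_oppr_neq zP); first by lia.
by rewrite subr_eq0 eq_sym (root_chain_neqV zP).
Qed.

End GaloisConsequences.

(** * Arithmetic of the base field: nu, nu^+ and property C_2 *)

Section BaseField.

Variables (F : fieldType) (Fbar : closedFieldType).
Variables (iota : {rmorphism F -> Fbar}) (zeta : nat -> Fbar).
Hypothesis zetaP : compatible_roots zeta.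

Local Notation inF := (in_base iota).

Lemma in_baseD x y : inF x -> inF y -> inF (x + y).
Proof. by move=> [a ->] [b ->]; exists (a + b); rewrite rmorphD. Qed.

Lemma in_baseN x : inF x -> inF (- x).
Proof. by move=> [a ->]; exists (- a); rewrite rmorphN. Qed.

Lemma in_baseM x y : inF x -> inF y -> inF (x * y).
Proof. by move=> [a ->] [b ->]; exists (a * b); rewrite rmorphM. Qed.

Lemma in_baseV x : inF x -> inF x^-1.
Proof. by move=> [a ->]; exists a^-1; rewrite fmorphV. Qed.

Lemma in_baseX x n : inF x -> inF (x ^+ n).
Proof. by move=> [a ->]; exists (a ^+ n); rewrite rmorphXn. Qed.

Lemma in_base_nat n : inF n%:R.
Proof. by exists n%:R; rewrite rmorph_nat. Qed.

Lemma compatible_root_chain e : root_chain zeta e.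
Proof. by move=> k _; have [] := zetaP k. Qed.

Let zS k : zeta k.+1 ^+ 2 = zeta k. Proof. by have [_] := zetaP k. Qed.
Let z0 k : zeta k != 0.
Proof. exact: (root_chain_neq0 (@compatible_root_chain k)). Qed.
Let z1 : zeta 1 = -1. Proof. exact: (root_chain1 (@compatible_root_chain 1)). Qed.
Let z2 : zeta 2 ^+ 2 = -1. Proof. by rewrite zS z1. Qed.
Let two0 : 2 != 0 :> Fbar.
Proof. exact: (root_chain_char (@compatible_root_chain 1)). Qed.

Let zX k m : zeta (k + m)%N ^+ (2 ^ m) = zeta k.
Proof. exact: (root_chainX (@compatible_root_chain (k + m))). Qed.

Let zeta2_addV : zeta 2 + (zeta 2)^-1 = 0.
Proof. by apply: (mulfI (z0 2)); rewrite mulr0 mulrDr -expr2 mulfV // z2 addNr. Qed.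

Lemma half_in_base x : inF (x + x) -> inF x.
Proof.
move=> Fx; have ->: x = (x + x) / 2 by field.
by apply: in_baseM Fx _; apply/in_baseV/in_base_nat.
Qed.

Lemma zeta2_expn_odd n : odd n -> inF (zeta 2 ^+ n) -> inF (zeta 2).
Proof.
move=> odd_n; rewrite -[n]odd_double_half odd_n exprS -mul2n exprM z2 => Fz.
have ->: zeta 2 = zeta 2 * (-1) ^+ n./2 * (-1) ^+ n./2.
  by rewrite -mulrA -exprMn mulrNN mulr1 expr1n mulr1.
by apply: in_baseM Fz _; apply/in_baseX/in_baseN/(in_base_nat 1).
Qed.

Lemma in_base_addV k m : inF (zeta (k + m)%N + (zeta (k + m)%N)^-1) ->
  inF (zeta k + (zeta k)^-1).
Proof.
elim: m => [|m IHm]; first by rewrite addn0.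
rewrite addnS => Fz; apply: IHm.
have ->: zeta (k + m)%N + (zeta (k + m)%N)^-1 =
    (zeta (k + m).+1 + (zeta (k + m).+1)^-1) ^+ 2 + (- 2).
  by rewrite -(zS (k + m)); field; rewrite z0.
by apply: in_baseD (in_baseX _ Fz) _; apply/in_baseN/in_base_nat.
Qed.

Lemma in_base_root k m : inF (zeta (k + m)%N) -> inF (zeta k).
Proof. by rewrite -(zX k m); apply: in_baseX. Qed.

Section NoI.

Hypothesis z2_notin : ~ inF (zeta 2).

Lemma in_base_expn_dvd k n : inF (zeta k.+2 ^+ n) -> (2 ^ k.+1 %| n)%N.
Proof.
elim: k n => [|k IHk] n Fz.
  by rewrite dvdn2; apply/negP=> /zeta2_expn_odd/(_ Fz).
(* Squaring lowers the level and shows that n is even; then [zeta k.+3 ^+ n] is the power n / 2 of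
   [zeta k.+2], and a second use of the hypothesis gains the factor 2. *)
have dvd_n: (2 ^ k.+1 %| n)%N.
  by apply: IHk; rewrite -zS -exprM mulnC exprM; apply: in_baseX.
have [m Dn]: exists m, n = (2 * m)%N.
  exists (n %/ 2)%N; rewrite mulnC divnK // (dvdn_trans _ dvd_n) //.
  by rewrite expnS dvdn_mulr.
rewrite Dn expnS dvdn_pmul2l //; apply: IHk.
by rewrite -zS -exprM -Dn.
Qed.

Lemma has_oF_zeta k : (1 < k)%N -> has_oF iota (zeta k) (2 ^ k.-1).
Proof.
case: k => [|[|k]] // _; split=> /=; first by rewrite expn_gt0.
  by rewrite -add1n zX z1; apply/in_baseN/(in_base_nat 1).
by move=> n n_gt0 /in_base_expn_dvd/dvdn_leq; apply.
Qed.

(** With zeta_4 outside F, o_F(zeta_{2^k}) = 2^(k-1) exceeds 2 once k > 2, so t_F(2^k) = 2^k. At k =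
    2 both sides hold: t_F(4) = 2 gives the sum -2, and zeta_4 + 1/zeta_4 = 0. *)
Lemma nu_plus_condE k : (1 < k)%N ->
  nu_plus_cond iota zeta k <-> inF (zeta k + (zeta k)^-1).
Proof.
move=> k_gt1; have ok := has_oF_zeta k_gt1.
have [k2 | k_neq2] := eqVneq k 2%N.
  have inF0: inF (zeta k + (zeta k)^-1).
    by rewrite k2 zeta2_addV; apply: (in_base_nat 0).
  split=> // _; exists (2 ^ k.-1)%N; split=> //; rewrite k2 /tF_exp /= z1.
  by apply: in_baseD; last apply: in_baseV; apply/in_baseN/(in_base_nat 1).
have m_gt2: (2 < 2 ^ k.-1)%N.
  by rewrite -{1}(expn1 2) ltn_exp2l //; move: k_gt1 k_neq2; case: (k) => [|[|[]]].
split=> [[m [om Fz]] | Fz].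
  suff Dm: m = (2 ^ k.-1)%N by rewrite Dm /tF_exp m_gt2 in Fz.
  case: ok => ok1 ok2 ok3; case: om => om1 om2 om3.
  by apply/eqP; rewrite eqn_leq om3 ?ok3.
by exists (2 ^ k.-1)%N; rewrite /tF_exp m_gt2.
Qed.

(** [zeta 0] and [zeta 1] are 1 and -1, and at k = 2 the difference is twice [zeta 2]. *)
Lemma property_C2_exp k : ~ inF (zeta k) -> inF (zeta k - (zeta k)^-1) -> (2 < k)%N.
Proof.
case: k => [|[|[|k]]] // nF Fz; case: nF.
- have [/prim_expr_order] := zetaP 0; rewrite expr1 => -> _.
  exact: (in_base_nat 1).
- by rewrite z1; apply/in_baseN/(in_base_nat 1).
apply: half_in_base; suff {1}->: zeta 2 = - (zeta 2)^-1 by rewrite addrC.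
by apply: (mulfI (z0 2)); rewrite mulrN mulfV // -expr2 z2.
Qed.

End NoI.

(** The condition always holds at 2: if zeta_4 is in F then t_F(4) = 1 and the sum is 2; otherwise
    [nu_plus_condE] applies, with sum 0. *)
Lemma nu_plus_gt1 n : is_nu_plus iota zeta n -> (1 < n)%N.
Proof.
case=> _ max_n; rewrite ltnNge; apply/negP=> n_le1.
have no2: ~ nu_plus_cond iota zeta 2 by move/max_n/leq_trans/(_ n_le1).
have z2_notin: ~ inF (zeta 2).
  move=> Fz2; apply: no2; exists 1%N; split; first by split.
  rewrite /tF_exp /=; have [/prim_expr_order] := zetaP 0; rewrite expr1 => -> _.
  by rewrite invr1; apply: (in_base_nat 2).
apply/no2/(nu_plus_condE z2_notin) => //; rewrite zeta2_addV.
exact: (in_base_nat 0).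
Qed.

Lemma is_nu_plus_uniq n1 n2 :
  is_nu_plus iota zeta n1 -> is_nu_plus iota zeta n2 -> n1 = n2.
Proof.
move=> [c1 m1] [c2 m2]; apply/eqP.
by rewrite eqn_leq (m2 _ c1) (m1 _ c2).
Qed.

Lemma is_nu_ge nu nup :
  is_nu iota zeta nu -> is_nu_plus iota zeta nup -> (nup <= nu)%N.
Proof.
case=> np [npP nuP] nupP; rewrite (is_nu_plus_uniq nupP npP).
by case: nuP => [] [_ ->].
Qed.

(** A witness k of C_2 must be nu^+ + 1, which is then nu: squaring zeta_{2^k} - 1/zeta_{2^k} gives
    k - 1 <= nu^+, while k <= nu^+ would put zeta_{2^k} + 1/zeta_{2^k}, hence zeta_{2^k}, in F. *)
Lemma no_property_C2 nu : is_nu iota zeta nu ->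
    ~ inF (zeta 2) -> ~ inF (zeta nu - (zeta nu)^-1) ->
  ~ property_C2 iota zeta.
Proof.
case=> np [[np_cond np_max] [[_ Dnu] | [] //]] z2_notin nu_minus.
have np_gt1 := nu_plus_gt1 (conj np_cond np_max).
case=> k [nFk _ Fk]; apply: nu_minus; rewrite Dnu; suff ->: np.+1 = k by [].
have k_gt2 := property_C2_exp nFk Fk; case: k nFk Fk k_gt2 => // k nFk Fk k_gt1.
congr _.+1; apply/eqP; rewrite eqn_leq andbC; apply/andP; split.
  apply/np_max/(nu_plus_condE z2_notin) => //.
  have ->: zeta k + (zeta k)^-1 = (zeta k.+1 - (zeta k.+1)^-1) ^+ 2 + 2.
    by rewrite -(zS k); field; rewrite z0.
  by apply: in_baseD (in_baseX _ Fk) (in_base_nat 2).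
rewrite leqNgt; apply/negP=> lt_k_np; apply: nFk; apply: half_in_base.
have ->: zeta k.+1 + zeta k.+1 =
    zeta k.+1 + (zeta k.+1)^-1 + (zeta k.+1 - (zeta k.+1)^-1) by ring.
apply: in_baseD Fk; apply: (in_base_addV (m := np - k.+1)).
by rewrite subnKC //; apply/(nu_plus_condE z2_notin).
Qed.

(** Turns (5) into the hypotheses of the Galois part. Without C_2, nu is nu^+, whose maximality
    excludes the sum at level nu + 1; the difference there in F would witness C_2. *)
Lemma condition5P nu nup : is_nu iota zeta nu -> is_nu_plus iota zeta nup ->
    ~ inF (zeta 2) -> ~ inF (zeta nu - (zeta nu)^-1) ->
  [/\ nu = nup, inF (zeta nu + (zeta nu)^-1),
      ~ inF (zeta nu.+1 + (zeta nu.+1)^-1) &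
      ~ inF (zeta nu.+1 - (zeta nu.+1)^-1)].
Proof.
move=> nuP nupP z2_notin nu_minus.
have noC2 := no_property_C2 nuP z2_notin nu_minus.
have nup_gt1 := nu_plus_gt1 nupP.
have Dnu: nu = nup.
  case: nuP => np [npP [[] // | [_ ->]]]; exact: is_nu_plus_uniq npP nupP.
rewrite Dnu; case: nupP => cond_nup max_nup; split=> //.
- exact/(nu_plus_condE z2_notin).
- move=> Fz; suff /max_nup: nu_plus_cond iota zeta nup.+1 by rewrite ltnn.
  by apply/(nu_plus_condE z2_notin) => //; apply: ltnW.
move=> Fz; apply: noC2; exists nup.+1; split=> //; last first.
  by apply: has_oF_zeta => //; apply: ltnW.
move=> Fzn; apply: z2_notin; apply: (in_base_root (m := nup.+1 - 2)).
by rewrite subnKC // ltnW.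
Qed.

(** X^p - X has at most p roots, and the integers below p already give p distinct ones. *)
Lemma frobenius_fixed_in_base p x : p \in [pchar F] -> x ^+ p = x -> inF x.
Proof.
move=> pcharFp xp; have pcharKp: p \in [pchar Fbar] by rewrite (fmorph_pchar iota).
have p_pr := pcharf_prime pcharFp.
pose r : seq Fbar := [seq i%:R | i <- seq.iota 0 p].
have [/mapP[i _ ->] | r'x] := boolP (x \in r); first exact: in_base_nat.
have inj_nat: {in seq.iota 0 p &, injective (fun i => i%:R : Fbar)}.
  move=> i k; rewrite !mem_iota /= add0n.
  wlog le_ik: i k / (i <= k)%N => [IH lt_i lt_k eq_ik|lt_i lt_k eq_ik].
    by case/orP: (leq_total i k) => le; [apply: IH | apply/esym/IH].
  apply/eqP; rewrite eqn_leq le_ik -subn_eq0.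
  have: (k - i)%:R == 0 :> Fbar by rewrite natrB // eq_ik subrr.
  rewrite -(dvdn_pcharf pcharKp) => dvd_p; rewrite -leqn0 leqNgt.
  apply/negP=> /dvdn_leq/(_ dvd_p); rewrite leqNgt => /negP; apply.
  by rewrite (leq_ltn_trans (leq_subr _ _)).
pose P : {poly Fbar} := 'X^p - 'X.
have szP: size P = p.+1.
  by rewrite size_polyDl size_polyXn // size_polyN size_polyX ltnS prime_gt1.
have: (size (x :: r) < size P)%N.
  apply: max_poly_roots; first by rewrite -size_poly_gt0 szP.
    apply/allP=> y; rewrite inE => /predU1P[->|/mapP[i _ ->]].
      by rewrite rootE !hornerE xp subrr.
    by rewrite rootE !hornerE -(pFrobenius_autE pcharKp) rmorph_nat subrr.
  by rewrite /= r'x map_inj_in_uniq ?iota_uniq.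
by rewrite /= size_map size_iota szP ltnn.
Qed.

(* Write p + 1 = 2^s u with u odd: z = zeta (s + 1) has z^p = -1/z, so Frobenius
   fixes z - 1/z. *)
Lemma pchar_property_C2 p : p \in [pchar F] -> ~ inF (zeta 2) ->
  property_C2 iota zeta.
Proof.
move=> pcharFp z2_notin.
have pcharKp: p \in [pchar Fbar] by rewrite (fmorph_pchar iota).
have p_pr := pcharf_prime pcharFp.
have odd_p: odd p.
  case: (even_prime p_pr) => // p2; case/eqP: two0.
  by move: (pcharf0 pcharKp); rewrite p2.
pose s := logn 2 p.+1; pose u := (p.+1 %/ 2 ^ s)%N.
have Dp: p.+1 = (2 ^ s * u)%N by rewrite mulnC divnK // pfactor_dvdnn.
have odd_u: odd u.
  have := @pfactor_coprime 2 p.+1 isT isT; case=> m; rewrite coprime2n => odd_m Dm.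
  suff ->: u = m by [].
  by rewrite /u {1}Dm mulnK // expn_gt0.
(* p + 1 is even, so s >= 1; if s = 1 then p is 1 modulo 4 and Frobenius fixes [zeta 2]. *)
have s_gt1: (1 < s)%N.
  rewrite ltnNge; apply/negP=> s_le1; apply: z2_notin.
  apply: (frobenius_fixed_in_base pcharFp).
  have s1: s = 1%N.
    move: s_le1 Dp; case: (s) => [|[]] // _; rewrite mul1n => Dp.
    by move: odd_u; rewrite -Dp /= odd_p.
  have Dp4: (p = 4 * u./2 + 1)%N.
    by move: Dp (odd_double_half u); rewrite s1 odd_u; lia.
  by rewrite Dp4 addn1 exprSr exprM -[4%N]/(2 * 2)%N exprM z2 sqrrN !expr1n mul1r.
set w := zeta s.+1.
have wp: w ^+ p = - w^-1.
  apply: (mulIf (z0 s.+1)); rewrite -exprSr Dp exprM /w -(add1n s) zX z1.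
  by rewrite mulNr mulVf ?z0 // -signr_odd odd_u expr1.
exists s.+1; split.
- move=> Fw; apply: z2_notin; apply: (in_base_root (m := s.+1 - 2)).
  by rewrite subnKC // ltnW.
- by apply: has_oF_zeta => //; apply: ltnW.
apply: (frobenius_fixed_in_base pcharFp); rewrite -/w.
rewrite -(pFrobenius_autE pcharKp) rmorphB fmorphV /= pFrobenius_autE wp.
by rewrite invrN invrK opprK addrC.
Qed.

End BaseField.

(** * Equivalence of the five assertions *)

Theorem theorem4p1
  (F : fieldType) (charF : 2%N \notin [pchar F])
  (Fbar : closedFieldType) (iota : {rmorphism F -> Fbar})
  (Fbar_alg : forall x : Fbar, algebraicOver iota x)
  (zeta : nat -> Fbar) (zetaP : compatible_roots zeta)
  (nu nup : nat) (nuP : is_nu iota zeta nu) (nupP : is_nu_plus iota zeta nup)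
  (e : nat) (lt_nu_e : (nu < e)%N)
  (L : splittingFieldType F) (j : {rmorphism L -> Fbar})
  (jP : forall a : F, j a%:A = iota a)
  (z : nat -> L) (zP : forall k, (k <= e)%N -> j (z k) = zeta k) :
  [<->
    ~~ cyclic 'Gal(Fzeta z e / 1);

    exists s t : gal_of (Fzeta z e),
      [/\ is_sigma (z e) (-1) s,
          is_sigma (z e) (5 ^ (2 ^ (e - 3)))%N%:Z t &
          #|<<[set s; t]>>%g| = 4%N];

    uniq [:: Fzeta z e.-1; Fplus z e; Fminus z e] /\
      (forall M : {subfield L},
        index2 (Fzeta z e) M <->
        M \in [:: Fzeta z e.-1; Fplus z e; Fminus z e]);

    [/\ uniq (listed_towers z e nu nup),
        size (listed_towers z e nu nup) = (2 * (e - nu) + 1)%N &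
        forall t : seq {subfield L},
          two_tower (Fzeta z e) t <-> t \in listed_towers z e nu nup];

    ~ in_base iota (zeta 2%N) /\
      ~ in_base iota (zeta nu - (zeta nu)^-1)]
  /\
  (~~ cyclic 'Gal(Fzeta z e / 1) -> [pchar F] =i pred0).
Proof.
have nup_gt1 := nu_plus_gt1 zetaP nupP; have le_nu := is_nu_ge nuP nupP.
have nu_gt1 := leq_trans nup_gt1 le_nu.
have e_gt2: (2 < e)%N := leq_ltn_trans nu_gt1 lt_nu_e.
have zPL: root_chain z e.
  move=> k le_ke; have [prim_k zS] := zetaP k; split=> [|lt_ke].
    by rewrite -(fmorph_primitive_root j) zP.
  by apply: (fmorph_inj j); rewrite rmorphXn /= !zP.
have in1P x: reflect (in_base iota (j x)) (x \in 1%VS).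
  apply: (iffP (vlineP _ _)) => [[a ->]|[a ja]]; exists a; first exact: jP.
  by apply: (fmorph_inj j); rewrite jP.
(* The common way into (5): each of (1)-(4) yields an automorphism inverting [z e]. *)
have conj5: (exists s : gal_of (Fzeta z e), s (z e) = (z e)^-1) ->
    ~ in_base iota (zeta 2) /\ ~ in_base iota (zeta nu - (zeta nu)^-1).
  case=> s Ds; have [|z2 znu] := conj_notin zPL e_gt2 Ds (k := nu).
    by rewrite nu_gt1 ltnW.
  rewrite -!zP ?(ltnW lt_nu_e) ?(ltnW e_gt2) // -fmorphV -rmorphB.
  by split=> /in1P; apply/negP.
have noncyclic5 := conj5 (noncyclic_conj zPL e_gt2 _).
have generic: ~ in_base iota (zeta 2) /\ ~ in_base iota (zeta nu - (zeta nu)^-1) ->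
    [/\ nu = nup, z 2 \notin 1%VS, z nu + (z nu)^-1 \in 1%VS,
        z nu.+1 + (z nu.+1)^-1 \notin 1%VS & z nu.+1 - (z nu.+1)^-1 \notin 1%VS].
  case=> z2 znu; have [Dnu] := condition5P zetaP nuP nupP z2 znu.
  rewrite -!zP ?(ltnW lt_nu_e) // -!fmorphV -!rmorphB -!rmorphD.
  move=> p q m; split=> //; first by apply/in1P; rewrite zP // (ltnW e_gt2).
  - exact/in1P.
  - exact/in1P.
  exact/in1P.
split; last first.
  move=> ncyc p; rewrite inE; apply/negP=> pcharFp.
  have [z2 znu] := noncyclic5 ncyc.
  exact: (no_property_C2 zetaP nuP z2 znu (pchar_property_C2 zetaP pcharFp z2)).
have klein: ~ in_base iota (zeta 2) /\ ~ in_base iota (zeta nu - (zeta nu)^-1) ->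
    exists s t : gal_of (Fzeta z e), s (z e) = (z e)^-1 /\ t (z e) = - z e.
  case/generic=> Dnu z2 p q m.
  by apply: (exists_klein zPL nu_gt1 lt_nu_e z2 p q m); rewrite lt_nu_e leqnn.
(* The implications out of (1), (2) and (3) first derive (5), then obtain their goal from the Klein
   four-groups that (5) provides. *)
tfae.
- move=> /noncyclic5/klein[s [t [Ds Dt]]]; exists s, t; split.
  + by split; [apply: mem_gal1 | rewrite exprN1].
  + by split; [apply: mem_gal1 | rewrite -exprnP root_pow5].
  exact: card_klein Ds Dt.
- move=> [s0 [t0 [[_ Ds0] _ _]]].
  have /conj5/klein[s [t [Ds Dt]]]:
      exists s : gal_of (Fzeta z e), s (z e) = (z e)^-1.
    by exists s0; rewrite Ds0 exprN1.
  by split; [apply: uniq_index2_Fzeta Ds Dt | apply: index2_FzetaP Ds Dt].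
- move=> [_ iE]; have iEP: index2 (Fzeta z e) (Fplus z e).
    by apply/iE; rewrite !inE eqxx orbT.
  have /conj5/generic[Dnu z2 p q m] := index2_Fplus_conj zPL e_gt2 iEP.
  rewrite -Dnu; have neP: (nu <= e <= e)%N by rewrite leqnn ltnW.
  have [U T] := listed_towersP zPL nu_gt1 lt_nu_e z2 p q m neP.
  by split=> //; apply: size_listed.
- move=> [_ _ T]; apply: conj5; apply: (index2_Fplus_conj zPL e_gt2).
  (* Tower (b) with r = 0 begins with F(z e) over F(z e + 1/z e), so this step has degree 2. *)
  have: tower_b z e nup 0 \in listed_towers z e nu nup.
    rewrite inE mem_cat; apply/orP; right; apply/orP; left.
    by apply: map_f; rewrite mem_iota subn_gt0.
  move/T; case: (e) lt_nu_e => // k lt_nu_k; rewrite /tower_b subn0.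
  rewrite !downtoS ?ltnS ?(leq_trans le_nu) // /downto subnn /=.
  by rewrite eqxx /= => /andP[/andP[]].
by case/klein=> s [t [Ds Dt]]; apply: noncyclic_klein Ds Dt.
Qed.
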